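(* Let $1<\omega<\mu$ and let $G=G^\omega_\mu=(\mathbb{Z},w,m)$ be the linear graph given by $w(n,n+1)=\omega^{-n}$ and $m(n)=\mu^{-n}$ for $n\in\mathbb{Z}$. Then there are $K>0$ and $D<\infty$ such that $$\mathcal{K}_{G,x}(D)\ge K\left(\frac{\mu}{\omega}\right)^x\quad\text{for all }x\in\mathbb{Z}.$$
   Context: A weighted graph $G=(V,E,w,m)$ is a connected, undirected, simple, locally finite graph $(V,E)$ with vertex weights $m:V\to(0,\infty)$ and symmetric edge weights $w:E\to(0,\infty)$, $w(x,y)=w(y,x)$ (with $w(x,y)=0$ if $x\not\sim y$). A linear graph on $\mathbb{Z}$ has vertex set $V=\mathbb{Z}$ and edge set $E=\{\{n,n+1\}: n\in\mathbb{Z}\}$. The Laplacian is $\Delta f(x)=\frac1{m(x)}\sum_{y\sim x}w(x,y)(f(y)-f(x))$ for $f:V\to\mathbb{R}$. Set $\Gamma(f,g)=\frac12(\Delta(fg)-f\Delta g-g\Delta f)$, $\Gamma(f)=\Gamma(f,f)$, and $\Gamma_2(f)=\frac12\Delta\Gamma(f)-\Gamma(f,\Delta f)$. For $K\in\mathbb{R}$, $D\in(0,\infty]$ (with $1/\infty=0$) and $x\in V$, the condition $\mathrm{CD}(K,D,x)$ means $\Gamma_2(f)(x)\ge\frac1D(\Delta f(x))^2+K\,\Gamma(f)(x)$ for all $f:V\to\mathbb{R}$. Define $\mathcal{K}_{G,x}(D)=\sup\{K\in\mathbb{R}:\mathrm{CD}(K,D,x)\text{ holds}\}$. *)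

(* Defs.v *)
From mathcomp Require Import all_boot all_order all_algebra.
From mathcomp Require Import all_classical all_reals ereal.

Set Implicit Arguments.
Unset Strict Implicit.
Unset Printing Implicit Defensive.

Import Order.TTheory GRing.Theory Num.Theory.

Local Open Scope classical_set_scope.
Local Open Scope ring_scope.

Record weighted_graph (R : realType) (V : choiceType) := WeightedGraph {
  adj : rel V;
  eweight : V -> V -> R;
  vweight : V -> R;
  adj_sym : symmetric adj;
  adj_irr : irreflexive adj;
  adj_locally_finite : forall x, finite_set [set y | adj x y];
  adj_connected : forall x y, exists p : seq V, path adj x p /\ last x p = y;
  eweight_sym : forall x y, eweight x y = eweight y x;
  eweight_gt0 : forall x y, adj x y -> 0 < eweight x y;
  eweight_eq0 : forall x y, ~~ adj x y -> eweight x y = 0;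
  vweight_gt0 : forall x, 0 < vweight x
}.

Section BakryEmery.
Variables (R : realType) (V : choiceType) (G : weighted_graph R V).

Definition laplacian (f : V -> R) (x : V) : R :=
  (vweight G x)^-1 *
    \sum_(y \in [set y | adj G x y]) eweight G x y * (f y - f x).

Definition Gamma (f g : V -> R) (x : V) : R :=
  2^-1 * (laplacian (fun y => f y * g y) x
          - f x * laplacian g x - g x * laplacian f x).

Definition Gamma2 (f : V -> R) (x : V) : R :=
  2^-1 * laplacian (Gamma f f) x - Gamma f (laplacian f) x.

(* Meant for 0 < D <= +oo; (D^-1)%E is 0 at D = +oo. *)
Definition CD (K : R) (D : \bar R) (x : V) : Prop :=
  forall f : V -> R,
    fine (D^-1)%E * laplacian f x ^+ 2 + K * Gamma f f x <= Gamma2 f x.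

(* The supremum is taken in \bar R: -oo if CD holds for no K, +oo if it holds
   for arbitrarily large K. *)
Definition curvature (D : \bar R) (x : V) : \bar R :=
  ereal_sup [set K%:E | K in [set K : R | CD K D x]].

End BakryEmery.

Definition linear_adj : rel int := fun x y => (y == x + 1) || (x == y + 1).

(* w n is the weight of the edge {n, n + 1}. *)
Definition linear_eweight (R : realType) (w : int -> R) (x y : int) : R :=
  if linear_adj x y then w (Num.min x y) else 0.

Lemma linear_adj_sym : symmetric linear_adj.
Proof. by move=> x y; rewrite /linear_adj orbC. Qed.

Lemma linear_adj_irr : irreflexive linear_adj.
Proof.
by move=> x; rewrite /linear_adj orbb -{1}[x]addr0 (inj_eq (addrI x)).
Qed.

Lemma linear_adj_locally_finite x : finite_set [set y | linear_adj x y].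
Proof.
apply: (@sub_finite_set _ _ [set x + 1; x - 1]) => [y /=|].
  by case/orP => /eqP ->; [left | right; rewrite addrK].
by rewrite finite_setU; split; exact: finite_set1.
Qed.

Lemma linear_adj_connected (x y : int) :
  exists p : seq int, path linear_adj x p /\ last x p = y.
Proof.
have up n : exists p : seq int, path linear_adj x p /\ last x p = x + n%:Z.
  elim: n => [|n [p [pP pl]]]; first by exists [::]; rewrite addr0.
  exists (rcons p (x + n.+1%:Z)); rewrite last_rcons rcons_path pP pl; split=> //=.
  by rewrite /linear_adj -addrA -PoszD addn1 eqxx.
have dn n : exists p : seq int, path linear_adj x p /\ last x p = x - n%:Z.
  elim: n => [|n [p [pP pl]]]; first by exists [::]; rewrite subr0.
  exists (rcons p (x - n.+1%:Z)); rewrite last_rcons rcons_path pP pl; split=> //=.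
  by rewrite /linear_adj -addn1 PoszD opprD addrA subrK eqxx orbT.
have -> : y = x + (y - x) by rewrite addrC subrK.
by case: (y - x) => n; [exact: up | rewrite NegzE; exact: dn].
Qed.

Lemma linear_eweight_sym (R : realType) (w : int -> R) x y :
  linear_eweight w x y = linear_eweight w y x.
Proof. by rewrite /linear_eweight linear_adj_sym minC. Qed.

Lemma linear_eweight_gt0 (R : realType) (w : int -> R) :
  (forall n, 0 < w n) ->
  forall x y, linear_adj x y -> 0 < linear_eweight w x y.
Proof. by move=> w0 x y xy; rewrite /linear_eweight xy. Qed.

Lemma linear_eweight_eq0 (R : realType) (w : int -> R) x y :
  ~~ linear_adj x y -> linear_eweight w x y = 0.
Proof. by rewrite /linear_eweight => /negbTE ->. Qed.

Definition linear_graph (R : realType) (w m : int -> R)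
    (w_gt0 : forall n, 0 < w n) (m_gt0 : forall n, 0 < m n) :
    weighted_graph R int :=
  WeightedGraph linear_adj_sym linear_adj_irr linear_adj_locally_finite
    linear_adj_connected (linear_eweight_sym w) (linear_eweight_gt0 w_gt0)
    (@linear_eweight_eq0 R w) m_gt0.

Lemma exprzN_gt0 (R : realType) (a : R) :
  1 < a -> forall n : int, 0 < a ^ (- n).
Proof. by move=> a1 n; rewrite exprz_gt0 // (lt_trans ltr01). Qed.

Definition geometric_graph (R : realType) (omega mu : R)
    (omega_gt1 : 1 < omega) (omega_lt_mu : omega < mu) :
    weighted_graph R int :=
  linear_graph (exprzN_gt0 omega_gt1)
    (exprzN_gt0 (lt_trans omega_gt1 omega_lt_mu)).

(* Main.v *)
(** With [q = mu / omega], the vertex [x] has jump rates [q ^ x] to the right and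
    [omega * q ^ x] to the left, so [Gamma2 f x] is [(q ^ x) ^ 2] times a
    quadratic form, independent of [x], in the increments of [f] around [x].
    Minimizing over the two outer increments leaves a binary form whose
    determinant is positive because [1 < omega] and [1 < q]; being positive
    definite, it dominates both the [K] and the [1 / D] terms. *)

Require Import Defs.
From mathcomp Require Import all_boot all_order all_algebra.
From mathcomp Require Import all_classical all_reals ereal.
From mathcomp Require Import ring lra.

Import Order.TTheory GRing.Theory Num.Theory.

Local Open Scope ring_scope.

Lemma laplacian_linear_graph (R : realType) (w m : int -> R)
    (w_gt0 : forall n, 0 < w n) (m_gt0 : forall n, 0 < m n)
    (f : int -> R) (x : int) :
  laplacian (linear_graph w_gt0 m_gt0) f x =
  (m x)^-1 * (w x * (f (x + 1) - f x) + w (x - 1) * (f (x - 1) - f x)).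
Proof.
rewrite /laplacian /=; congr (_ * _).
have -> : [set y | linear_adj x y]%classic = ([set x + 1] `|` [set x - 1])%classic.
  apply/seteqP; split => y; rewrite /linear_adj /=.
    by case/orP => /eqP ->; [left | right; rewrite addrK].
  by case=> ->; rewrite ?eqxx // subrK eqxx orbT.
(* The two neighbours are distinct, since [x + 1 = x - 1] would force [1 = -1]. *)
rewrite fsbigU //=; last first.
  by move=> y [/= -> /addrI].
rewrite !fsbig_set1 /linear_eweight /linear_adj eqxx subrK eqxx orbT.
by rewrite min_l ?min_r // ?lerDl // gerDl.
Qed.

Lemma laplacian_geometric_graph (R : realType) (omega mu : R)
    (omega_gt1 : 1 < omega) (omega_lt_mu : omega < mu) (f : int -> R) (x : int) :
  laplacian (geometric_graph omega_gt1 omega_lt_mu) f x =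
  (mu / omega) ^ x * ((f (x + 1) - f x) + omega * (f (x - 1) - f x)).
Proof.
have o0 : omega != 0 by rewrite gt_eqF // (lt_trans ltr01).
rewrite laplacian_linear_graph opprB expfzDr // expr1z invr_expz opprK.
by rewrite expfzMl exprz_inv; ring.
Qed.

Lemma Gamma_geometric_graph (R : realType) (omega mu : R)
    (omega_gt1 : 1 < omega) (omega_lt_mu : omega < mu) (f g : int -> R)
    (x : int) :
  Gamma (geometric_graph omega_gt1 omega_lt_mu) f g x =
  2^-1 * (mu / omega) ^ x *
    ((f (x + 1) - f x) * (g (x + 1) - g x)
     + omega * ((f (x - 1) - f x) * (g (x - 1) - g x))).
Proof. by rewrite /Gamma !laplacian_geometric_graph; ring. Qed.

(** Completing squares confines [c] and [e] to two nonnegative terms that vanish at [c = a],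
    [e = b]; the form left in [a] and [b] is thus the minimum over both. *)
Lemma Gamma2_geometric_graph (R : realType) (omega mu : R)
    (omega_gt1 : 1 < omega) (omega_lt_mu : omega < mu) (f : int -> R) (x : int) :
  let q := mu / omega in
  let a := f (x + 1) - f x in
  let b := f (x - 1) - f x in
  let c := f (x + 1 + 1) - f (x + 1) in
  let e := f (x - 1 - 1) - f (x - 1) in
  Gamma2 (geometric_graph omega_gt1 omega_lt_mu) f x =
  4^-1 * (q ^ x) ^+ 2 *
    ((3 * q * omega - q - omega + 1) * a ^+ 2 + 4 * omega * a * b
     + omega * (omega - 1 + (3 - omega) / q) * b ^+ 2
     + q * (c - a) ^+ 2 + omega ^+ 2 / q * (e - b) ^+ 2).
Proof.
move=> q a b c e.
have o0 : 0 < omega by rewrite (lt_trans ltr01).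
have q0 : q != 0 by rewrite gt_eqF // divr_gt0 // (lt_trans o0).
rewrite /Gamma2 laplacian_geometric_graph !Gamma_geometric_graph.
rewrite !laplacian_geometric_graph addrK subrK !expfzDr // -/q.
rewrite expr1z -[q ^ (-1)]/(q^-1) /a /b /c /e.
by field.
Qed.

(** Determinant over trace bounds the least eigenvalue of the symmetric matrix [M] of the form from
    below. By Cayley-Hamilton, [tr M * M - det M * I = M ^ 2], whose quadratic form is the sum of
    squares in the proof. *)
Lemma pos_binary_form_ge (R : realFieldType) (p r g a b : R) :
  0 < p -> 0 < r -> g ^+ 2 < p * r ->
  (p * r - g ^+ 2) / (p + r) * (a ^+ 2 + b ^+ 2) <=
  p * a ^+ 2 + 2 * g * a * b + r * b ^+ 2.
Proof.
move=> p0 r0 pr; have s0 : 0 < p + r by rewrite addr_gt0.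
rewrite mulrAC ler_pdivrMr // -subr_ge0.
have -> : (p * a ^+ 2 + 2 * g * a * b + r * b ^+ 2) * (p + r)
    - (p * r - g ^+ 2) * (a ^+ 2 + b ^+ 2)
    = (p * a + g * b) ^+ 2 + (g * a + r * b) ^+ 2 by ring.
by rewrite addr_ge0 ?sqr_ge0.
Qed.

Lemma geometric_graph_form_pos (R : realFieldType) (omega q : R) :
  1 < omega -> 1 < q ->
  let p := 3 * q * omega - q - omega + 1 in
  let r := omega * (omega - 1 + (3 - omega) / q) in
  [/\ 0 < p, 0 < r & (2 * omega) ^+ 2 < p * r].
Proof.
move=> o1 q1 p r; have q0 : 0 < q by lra.
have t0 : 0 < (omega - 1) * (q - 1) by rewrite mulr_gt0 // subr_gt0.
(* Indeed [p = (omega - 1) * (q - 1) + 2 * q * omega]. *)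
have p0 : 0 < p by rewrite /p; nra.
have pr : (2 * omega) ^+ 2 < p * r.
  rewrite -subr_gt0.
  have -> : p * r - (2 * omega) ^+ 2 = omega / q * ((omega - 1) * (q - 1))
      * (2 * (omega + 1) + (3 * omega - 1) * (q - 1)).
    by rewrite /p /r; field; rewrite gt_eqF.
  have s0 : 0 < (3 * omega - 1) * (q - 1) by rewrite mulr_gt0; lra.
  by rewrite !mulr_gt0 ?invr_gt0 ?subr_gt0 //; lra.
(* The sign of [r] is read off from [p * r > 0]. *)
split=> //; rewrite -(pmulr_rgt0 _ p0).
by apply: le_lt_trans pr; rewrite sqr_ge0.
Qed.

Theorem theorem5p6 (R : realType) (omega mu : R)
    (omega_gt1 : 1 < omega) (omega_lt_mu : omega < mu) :
  exists (K : R) (D : \bar R),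
    [/\ 0 < K, (0 < D < +oo)%E &
      forall x : int,
        ((K * (mu / omega) ^ x)%:E
           <= curvature (geometric_graph omega_gt1 omega_lt_mu) D x)%E].
Proof.
have o0 : 0 < omega by rewrite (lt_trans ltr01).
set q := mu / omega; have q1 : 1 < q by rewrite ltr_pdivlMr // mul1r.
have q0 : 0 < q by rewrite (lt_trans ltr01).
have [] := geometric_graph_form_pos _ _ _ omega_gt1 q1.
set p := (_ + 1); set r := (omega * _) => p0 r0 pr.
pose d := (p * r - (2 * omega) ^+ 2) / (p + r).
have d0 : 0 < d by apply: divr_gt0; [rewrite subr_gt0 | exact: addr_gt0].
(* [D] and [K = d / (4 * omega)] are chosen so that, once [4^-1 * (q ^ x) ^+ 2] is factored out, the
   [1 / D] and [K] terms each take at most half of [d / omega * n], with [n] as below. *)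
pose D := 8 * omega * (1 + omega) / d.
have D0 : 0 < D by rewrite divr_gt0 // !mulr_gt0 // addr_gt0.
exists (d / (4 * omega)), D%:E; split.
- by rewrite divr_gt0 // mulr_gt0.
- by rewrite lte_fin D0 ltry.
move=> x; apply: ereal_sup_ubound; exists (d / (4 * omega) * q ^ x) => // f.
rewrite inver gt_eqF //= Gamma2_geometric_graph Gamma_geometric_graph.
rewrite laplacian_geometric_graph -/q -/p -/r.
set a := f (x + 1) - f x; set b := f (x - 1) - f x.
set c := _ - f (x + 1); set e := _ - f (x - 1).
have form := pos_binary_form_ge _ _ _ _ a b p0 r0 pr; rewrite -/d in form.
have outer : 0 <= q * (c - a) ^+ 2 + omega ^+ 2 / q * (e - b) ^+ 2.
  have q_ge0 := ltW q0; rewrite addr_ge0 // mulr_ge0 ?sqr_ge0 //.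
  by rewrite mulr_ge0 ?sqr_ge0 ?invr_ge0.
(* Up to the factor [2^-1 * q ^ x], this is [Gamma f f x]. *)
pose n := a ^+ 2 + omega * b ^+ 2.
(* Cauchy-Schwarz for the weights [1] and [omega] *)
have cs : (a + omega * b) ^+ 2 <= (1 + omega) * n.
  rewrite -subr_ge0 /n.
  have -> : (1 + omega) * (a ^+ 2 + omega * b ^+ 2) - (a + omega * b) ^+ 2
    = omega * (a - b) ^+ 2 by ring.
  by rewrite mulr_ge0 ?sqr_ge0 // ltW.
have no : n <= omega * (a ^+ 2 + b ^+ 2).
  by rewrite /n mulrDr lerD2r ler_peMl ?sqr_ge0 // ltW.
have Dn : 4 * (D^-1 * (a + omega * b) ^+ 2) <= d / (2 * omega) * n.
  have -> : d / (2 * omega) * n = 4 * (D^-1 * ((1 + omega) * n)).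
    rewrite /D; field; rewrite !gt_eqF // addr_gt0 //.
  by rewrite ler_pM2l // ler_pM2l ?invr_gt0.
have dn : d / omega * n <= d * (a ^+ 2 + b ^+ 2).
  by rewrite -mulrA ler_pM2l // ler_pdivrMl.
have -> : D^-1 * (q ^ x * (a + omega * b)) ^+ 2
    + d / (4 * omega) * q ^ x * (2^-1 * q ^ x * (a * a + omega * (b * b)))
  = 4^-1 * (q ^ x) ^+ 2
    * (4 * (D^-1 * (a + omega * b) ^+ 2) + d / (2 * omega) * n).
  by rewrite /n; field; rewrite !gt_eqF.
apply: ler_wpM2l; first by rewrite mulr_ge0 ?sqr_ge0 ?invr_ge0.
apply: le_trans (lerD Dn (lexx _)) _.
have -> : d / (2 * omega) * n + d / (2 * omega) * n = d / omega * n.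
  by field; rewrite gt_eqF.
(* The cross term now matches [form] with [g = 2 * omega]; the squares in [outer] are dropped. *)
apply: (le_trans dn); have -> : 4 * omega = 2 * (2 * omega) by ring.
by rewrite -[leRHS]addrA ler_wpDr.
Qed.
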